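(* Let $\mu=\langle1^{m_1}2^{m_2}\cdots\rangle$ be a partition of $n$ and write $|m|=m_1+m_2+\cdots$. Let $NC(\mu)$ be the set of noncrossing partitions of $[n]=\{1,\dots,n\}$ having type $\mu$; that is, having $m_i$ blocks of size $i$ for $i=1,2,\dots$. Then $$\sum_{\pi\in NC(\mu)}C_{(\overline\pi:\pi)}=\frac{(n+|m|)!}{(n+1)!\,m_1!\,m_2!\cdots}.$$
   Context: The notation $\langle1^{m_1}2^{m_2}\cdots\rangle$ denotes the integer partition with $m_i$ parts equal to $i$, so $\sum_i i\,m_i=n$ (with $n\ge1$). A set partition $\pi$ of $[n]$ is noncrossing if there are no distinct blocks $p_i\neq p_j$ and elements $a<b<c<d$ with $a,c\in p_i$ and $b,d\in p_j$. The adjacent closure $\overline\pi$ of a noncrossing partition $\pi$ is the partition obtained from $\pi$ by successively merging any two blocks $S_1$ and $S_2$ such that $\max S_1=b$ and $\min S_2=b+1$ for some $b$, until no such pair remains. If $\overline\pi=\{p_1,\dots,p_k\}$, then $C_{(\overline\pi:\pi)}=\prod_{i=1}^kC_{n_i}$, where $n_i$ is the number of blocks of $\pi$ contained in $p_i$ and $C_m=\frac1{m+1}\binom{2m}m$ is the $m$-th Catalan number. *)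

(* Defs.v *)
From mathcomp Require Import all_boot all_order all_algebra.

Set Implicit Arguments.
Unset Strict Implicit.
Unset Printing Implicit Defensive.

(* The ground set [n] = {1, ..., n} is 'I_n, that is {0, ..., n-1}: the shift *)
(* by one preserves order, adjacency and block sizes. A set partition of [n]  *)
(* is pi : {set {set 'I_n}} such that partition pi [set: 'I_n].               *)

Section NoncrossingPartitions.

Variable n : nat.

Implicit Types (S : {set 'I_n}) (pi : {set {set 'I_n}}) (m : nat -> nat).

Definition noncrossing pi : bool :=
  [forall P in pi, forall Q in pi, (P != Q) ==>
    [forall a in P, forall b in Q, forall c in P, forall d in Q,
      ~~ [&& a < b, b < c & c < d]]].

Definition is_max (b : 'I_n) S : bool := (b \in S) && [forall x in S, x <= b].
Definition is_min (b : 'I_n) S : bool := (b \in S) && [forall x in S, b <= x].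

Definition adjacent S1 S2 : bool :=
  [exists b, exists c, [&& is_max b S1, is_min c S2 & c == b.+1 :> nat]].

Definition adj_merge pi : {set {set 'I_n}} :=
  if [pick s : {set 'I_n} * {set 'I_n}
        | [&& s.1 \in pi, s.2 \in pi & adjacent s.1 s.2]] is Some (S1, S2)
  then (S1 :|: S2) |: (pi :\ S1 :\ S2) else pi.

(* A merge removes at least one block, so #|pi| merges exhaust the adjacent   *)
(* pairs (adj_closure_maximal); adj_merge fixes pi once no pair is left. For  *)
(* a set partition pi the result does not depend on the pairs picked, since   *)
(* S1 determines S2 and conversely, and distinct merges commute.              *)
Definition adj_closure pi : {set {set 'I_n}} := iter #|pi| adj_merge pi.

(* m i is the number of parts equal to i >= 1; the value m 0 is never used.   *)
Definition part_mult m : Prop :=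
  (\sum_(1 <= i < n.+1) i * m i = n) /\ (forall i, n < i -> m i = 0).

(* Blocks have between 1 and n elements: i : 'I_n stands for the size i.+1.   *)
Definition has_type m pi : bool :=
  [forall i : 'I_n, #|[set B in pi | #|B| == i.+1]| == m i.+1].

Definition NC m : {set {set {set 'I_n}}} :=
  [set pi | [&& partition pi [set: 'I_n], noncrossing pi & has_type m pi]].

End NoncrossingPartitions.

Local Open Scope ring_scope.

Definition catalan (k : nat) : rat := ('C(2 * k, k))%:R / (k.+1)%:R.

Definition closure_weight (n : nat) (pi : {set {set 'I_n}}) : rat :=
  \prod_(p in adj_closure pi) catalan #|[set B in pi | B \subset p]|.

Local Close Scope ring_scope.

Lemma adjacent_neq (n : nat) (S1 S2 : {set 'I_n}) :
  adjacent S1 S2 -> S1 != S2.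
Proof.
case/existsP=> b /existsP[c /and3P[/andP[_ /forall_inP maxb]]].
case/andP=> cS2 _ /eqP cE; apply/eqP=> eS.
by move: (maxb c); rewrite eS cE ltnn => /(_ cS2).
Qed.

Lemma adj_closure_maximal (n : nat) (pi : {set {set 'I_n}}) :
  {in adj_closure pi &, forall S1 S2, ~~ adjacent S1 S2}.
Proof.
have noadj k (rho : {set {set 'I_n}}) : #|rho| <= k ->
  {in iter k (@adj_merge n) rho &, forall S1 S2, ~~ adjacent S1 S2}.
  elim: k rho => [|k IHk] rho le_rho.
    move=> S1 S2; move: le_rho; rewrite leqn0 cards_eq0 => /eqP-> /=.
    by rewrite inE.
  rewrite iterSr /adj_merge; case: pickP => [[S1 S2]|none] /=.
    case/and3P=> S1in S2in /adjacent_neq neS; apply: IHk.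
    rewrite -ltnS; apply: leq_trans le_rho.
    rewrite (cardsD1 S1 rho) S1in add1n ltnS (cardsD1 S2 (rho :\ S1)).
    rewrite !inE eq_sym neS S2in /= cardsU1 leq_add2r.
    by case: (_ \notin _).
  have fix_rho : adj_merge rho = rho.
    by rewrite /adj_merge; case: pickP => // s; rewrite none.
  rewrite -/(@adj_merge n) iter_fix // => S1 S2 S1in S2in.
  by have /= := none (S1, S2); rewrite S1in S2in /= => ->.
exact: noadj.
Qed.

(* Main.v *)
Require Import Defs.
From mathcomp Require Import all_boot all_order all_algebra.
From mathcomp Require Import mpoly zify ring.

Set Implicit Arguments.
Unset Strict Implicit.
Unset Printing Implicit Defensive.

Import Num.Theory GRing.Theory.

(** The proof compares two recursive structures through generating functions.
Give each block [B] a variable t_s, where s = #|B|, and let g_L be the sum, over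
the noncrossing partitions of L consecutive integers, of the closure weight
times the product of these variables; let G be the series with coefficients g_L.

In a noncrossing partition of an interval, the blocks that are not nested below
another block cover consecutive subintervals: each one starts just after the
maximum of the previous one. They form one class of the adjacent closure. Every
gap between two consecutive elements of a block carries a noncrossing partition
of its own, and no adjacency leaves a gap. So a block of size s together with
its gaps contributes t_s X^s G^(s-1), and, A being the sum of these terms over
s, G is the sum of the C_k A^k. This is [chain_sum_step] (removing the first
outer block), [block_sum_step] (removing the first element of a block) and
their translations [block_sum_coef] and [chain_sum_coef] into coefficients; a
closure weight splits along the gaps by [omegaU], which rests on the
description of the adjacent closure in [closure_components].

Since the Catalan series K satisfies K = 1 + z K^2, that identity says that
G = 1 + A G^2, that is, G = 1 + (the sum over s of t_s X^s G^(s+1)), the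
equation counting plane trees in which t_s marks the vertices with s+1
children. The proof starts from this equation: [gf] solves it modulo X^(n+1),
and [gf_exp_ballot] gives back the expansion in powers of A, for all powers of
G at once, with the ballot numbers as coefficients. As the sums over partitions
obey the same recursion, they are the coefficients of [gf] ([wsum_itv]).

Multiplying the equation by G^r relates G^(r+1) to G^r and to powers
G^(r+s+1) with one variable t_s taken out. By induction, the coefficient in
G^r of X^L times the product of the t_i^(mu_i), where L is the sum of the
i mu_i, is r (L+|mu|+r-1)! / ((L+r)! mu_1! mu_2! ...) ([gf_exp_coeff]). The
theorem is the case r = 1, L = n, with t_s the variables of a polynomial ring
over the rationals. *)

Lemma prod_setU (R : comNzRingType) (I : finType) (A B : {set I}) (F : I -> R) :
  [disjoint A & B] ->
  (\prod_(i in A :|: B) F i = (\prod_(i in A) F i) * (\prod_(i in B) F i))%R.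
Proof. by move=> dAB; rewrite -bigU //; apply: eq_bigl => i; rewrite !inE. Qed.

(** * The adjacent closure as a partition into components *)

Section Closure.

Variable n : nat.
Implicit Types (D S Z p B : {set 'I_n}) (pi Q : {set {set 'I_n}}).

(** Each class of the adjacent closure is a smallest nonempty set that is stable
in this sense. Adjacency of blocks is expressed through their extremal elements
because these survive a merge, whereas the blocks do not. *)
Definition stable pi Z : Prop :=
  {in pi, forall B, {in B &, forall x y, (x \in Z) = (y \in Z)}} /\
  {in pi &, forall B1 B2 b c, is_max b B1 -> is_min c B2 ->
     c = b.+1 :> nat -> (b \in Z) = (c \in Z)}.

(** The last condition says that the members of [Q] cannot be split further,
which makes [Q] unique. *)
Definition components D pi Q : Prop :=
  [/\ partition Q D, {in Q, forall p, stable pi p} &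
      {in Q, forall p Z x, stable pi Z -> x \in p -> x \in Z -> p \subset Z}].

Lemma is_maxP b S :
  reflect (b \in S /\ {in S, forall x : 'I_n, x <= b}) (is_max b S).
Proof. by apply: (iffP andP) => -[bS /forall_inP]. Qed.

Lemma is_minP b S :
  reflect (b \in S /\ {in S, forall x : 'I_n, b <= x}) (is_min b S).
Proof. by apply: (iffP andP) => -[bS /forall_inP]. Qed.

Lemma partition_in_eq D pi B B' x :
  partition pi D -> B \in pi -> B' \in pi -> x \in B -> x \in B' -> B = B'.
Proof.
case/and3P=> _ /trivIsetP tI _ Bpi B'pi xB xB'; apply/eqP; apply/contraT.
by move/(tI _ _ Bpi B'pi)/pred0P/(_ x); rewrite /= xB xB'.
Qed.

Lemma partition_mem D pi x : partition pi D ->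
  x \in D -> exists2 B, B \in pi & x \in B.
Proof. by case/and3P=> /eqP <- _ _ /bigcupP[B Bpi xB]; exists B. Qed.

Lemma partition_sub D pi B : partition pi D -> B \in pi -> B \subset D.
Proof. by case/and3P=> /eqP <- _ _ Bpi; apply: bigcup_sup. Qed.

Lemma partition_nonempty D pi B : partition pi D -> B \in pi ->
  exists x, x \in B.
Proof.
by case/and3P=> _ _ n0 Bpi; apply/set0Pn; apply: contraNneq n0 => <-.
Qed.

Lemma partition_intro D pi :
  {in pi, forall B, B \subset D} ->
  {in D, forall x, exists2 B, B \in pi & x \in B} ->
  {in pi &, forall B B' x, x \in B -> x \in B' -> B = B'} ->
  {in pi, forall B, exists x, x \in B} -> partition pi D.
Proof.
move=> sD cD dj n0; apply/and3P; split.
- apply/eqP/setP=> x; apply/bigcupP/idP => [[B Bpi xB]|/cD[B]].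
    exact: (subsetP (sD _ Bpi)).
  by exists B.
- apply/trivIsetP=> B B' Bpi B'pi neq; apply/pred0P=> x /=.
  by apply: contraNF neq => /andP[xB xB']; apply/eqP/(dj _ _ _ _ x).
- by apply/negP=> /n0[x]; rewrite inE.
Qed.

Lemma components_uniq D pi Q Q' :
  components D pi Q -> components D pi Q' -> Q = Q'.
Proof.
suff sub P P' : components D pi P -> components D pi P' -> P \subset P'.
  by move=> h h'; apply/eqP; rewrite eqEsubset !sub.
case=> pP sP aP [pP' sP' aP']; apply/subsetP=> p pin.
have [x xp] := partition_nonempty pP pin.
have [p' p'in xp'] : exists2 p', p' \in P' & x \in p'.
  by apply: (partition_mem pP'); apply: (subsetP (partition_sub pP pin)).
suff -> : p = p' by [].
apply/eqP; rewrite eqEsubset (aP _ pin _ x) ?(aP' _ p'in _ x) //.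
  exact: sP.
exact: sP'.
Qed.

Lemma merge_partition D pi S1 S2 :
  partition pi D -> S1 \in pi -> S2 \in pi ->
  partition ((S1 :|: S2) |: (pi :\ S1 :\ S2)) D.
Proof.
move=> ppi i1 i2; have [s1 s2] := (partition_sub ppi i1, partition_sub ppi i2).
apply: partition_intro.
- by move=> B; rewrite !inE => /orP[/eqP->|/and3P[_ _ /(partition_sub ppi)]//];
    rewrite subUset s1 s2.
- move=> x /(partition_mem ppi)[B Bpi xB].
  have [e1|n1] := eqVneq B S1.
    by exists (S1 :|: S2); rewrite !inE ?eqxx // -e1 xB.
  have [e2|n2] := eqVneq B S2.
    by exists (S1 :|: S2); rewrite !inE ?eqxx // -e2 xB orbT.
  by exists B; rewrite // !inE n1 n2 Bpi orbT.
- have dj B x : x \in S1 :|: S2 -> B != S2 -> B != S1 -> B \in pi -> x \in B ->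
    S1 :|: S2 = B.
    rewrite inE => xU n2 n1 Bpi xB; case/orP: xU => xS.
      by move: n1; rewrite (partition_in_eq ppi Bpi i1 xB xS) eqxx.
    by move: n2; rewrite (partition_in_eq ppi Bpi i2 xB xS) eqxx.
  move=> B B'; rewrite !in_setU1 !in_setD1.
  move=> /orP[/eqP->|/and3P[n2 n1 Bpi]] /orP[/eqP->|/and3P[n2' n1' Bpi']] x //.
  + by move=> xU xB; apply: (dj _ x).
  + by move=> xB xU; apply/esym/(dj _ x).
  + exact: partition_in_eq ppi Bpi Bpi'.
- move=> B; rewrite !inE => /orP[/eqP->|/and3P[_ _ /(partition_nonempty ppi)]//].
  by have [x xS] := partition_nonempty ppi i1; exists x; rewrite inE xS.
Qed.

(** Merging forgets only the link between the maximum of [S1] and the minimum of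
[S2], and this link is recovered from their being in one block. All other ends
and starts of blocks are unchanged. *)
Lemma merge_stable pi S1 S2 Z :
  S1 \in pi -> S2 \in pi -> adjacent S1 S2 ->
  stable ((S1 :|: S2) |: (pi :\ S1 :\ S2)) Z <-> stable pi Z.
Proof.
move=> i1 i2 /existsP[b0 /existsP[c0 /and3P[mb mc /eqP ebc]]].
have [b0S le_b0] := is_maxP _ _ mb; have [c0S ge_c0] := is_minP _ _ mc.
set U := S1 :|: S2; set pi' := _ |: _.
have Upi : U \in pi' by rewrite !inE eqxx.
have inU B : B \in pi' -> B = U \/ B \in pi.
  by rewrite !inE => /orP[/eqP|/and3P[]]; auto.
have outU B : B \in pi -> B \in pi' \/ (B = S1 \/ B = S2).
  rewrite !inE => ->; case: (eqVneq B S1) => [|_]; first by auto.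
  by case: (eqVneq B S2) => [|_]; [auto | rewrite orbT; auto].
have maxU b : is_max b U <-> is_max b S2.
  split=> /is_maxP[bi le_b]; apply/is_maxP; split.
  - case/setUP: bi => // /le_b0 bb0; have := le_b c0; rewrite inE c0S orbT.
    by move=> /(_ isT); lia.
  - by move=> x xS; apply: le_b; rewrite inE xS orbT.
  - by rewrite inE bi orbT.
  - by move=> x /setUP[/le_b0|/le_b //]; move/ge_c0: bi; lia.
have minU c : is_min c U <-> is_min c S1.
  split=> /is_minP[ci ge_c]; apply/is_minP; split.
  - case/setUP: ci => // /ge_c0 cc0; have := ge_c b0; rewrite inE b0S.
    by move=> /(_ isT); lia.
  - by move=> x xS; apply: ge_c; rewrite inE xS.
  - by rewrite inE ci.
  - by move=> x /setUP[/ge_c //|/ge_c0]; move/le_b0: ci; lia.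
have [S1U S2U] : {subset S1 <= U} /\ {subset S2 <= U}.
  by split=> x xS; rewrite inE xS ?orbT.
split=> -[sat lnk]; split.
- move=> B /outU[Bpi'|[->|->]] x y xB yB; first exact: (sat B).
    by apply: (sat U) => //; apply: S1U.
  by apply: (sat U) => //; apply: S2U.
- move=> B1 B2 p1 p2 b c m1 m2 e.
  have [bB _] := is_maxP _ _ m1; have [cB _] := is_minP _ _ m2.
  have satU : b \in U -> c \in U -> (b \in Z) = (c \in Z) by apply: sat.
  (* A link leaving S1 or entering S2 can only be the one inside U. *)
  case: (outU _ p1) => [p1'|[E1|E1]]; case: (outU _ p2) => [p2'|[E2|E2]].
  + exact: (lnk B1 B2).
  + by apply: (lnk B1 U) => //; apply/minU; rewrite -E2.
  + have [_ ge_c] := is_minP _ _ m2; subst B2.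
    have ec : c = c0.
      by apply/val_inj/eqP; rewrite /= eqn_leq ge_c ?ge_c0.
    have -> : b = b0 by apply/val_inj/succn_inj; rewrite -e -ebc ec.
    by apply: (sat U) => //; [apply: S1U|apply: S2U].
  + have [_ le_b] := is_maxP _ _ m1; subst B1.
    have eb : b = b0.
      by apply/val_inj/eqP; rewrite /= eqn_leq le_b ?le_b0.
    have -> : c = c0 by apply: val_inj; rewrite /= e eb.
    by subst b; apply: (sat U) => //; [apply: S1U|apply: S2U].
  + by subst B1 B2; apply: satU; apply: S1U.
  + by subst B1 B2; apply: satU; [apply: S1U|apply: S2U].
  + by apply: (lnk U B2) => //; apply/maxU; rewrite -E1.
  + by subst B1 B2; apply: satU; [apply: S2U|apply: S1U].
  + by subst B1 B2; apply: satU; apply: S2U.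
- have eZ : (b0 \in Z) = (c0 \in Z) by apply: (lnk S1 S2).
  have toZ x : x \in U -> (x \in Z) = (b0 \in Z).
    by case/setUP=> xS; [|rewrite eZ]; [apply: (sat S1)|apply: (sat S2)].
  move=> B /inU[->|Bpi]; last exact: sat.
  by move=> x y xU yU; rewrite !toZ.
- have eZ : (b0 \in Z) = (c0 \in Z) by apply: (lnk S1 S2).
  have toZ x : x \in U -> (x \in Z) = (b0 \in Z).
    by case/setUP=> xS; [|rewrite eZ]; [apply: (sat S1)|apply: (sat S2)].
  move=> B1 B2 /inU[->|p1] /inU[->|p2] b c.
  + by case/is_maxP=> bU _ /is_minP[cU _] _; rewrite !toZ.
  + by move=> mb1 mc2 e; apply: (lnk S2 B2) => //; apply/maxU.
  + by move=> mb1 mc2 e; apply: (lnk B1 S1) => //; apply/minU.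
  + exact: lnk.
Qed.

(** When no adjacent pair is left, being stable just means being a union of
blocks, so the blocks are the components; by [merge_stable] every merge keeps
the components. In particular the pairs picked do not matter. *)
Lemma closure_components D pi :
  partition pi D -> components D pi (adj_closure pi).
Proof.
have fixed rho : partition rho D ->
    {in rho &, forall S1 S2, ~~ adjacent S1 S2} ->
    components D rho rho.
  move=> prho noadj; split=> // [p pin|p pin Z x [sat _] xp xZ].
    split=> [B Bin x y xB yB|B1 B2 i1 i2 b c mb mc e].
      by apply/idP/idP => h; rewrite -(partition_in_eq prho Bin pin _ h).
    case/negP: (noadj _ _ i1 i2); apply/existsP; exists b; apply/existsP.
    by exists c; rewrite mb mc e eqxx.
  by apply/subsetP=> y yp; rewrite -(sat _ pin x).
suff main k (rho : {set {set 'I_n}}) : #|rho| <= k -> partition rho D ->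
    components D rho (iter k (@adj_merge n) rho) by apply: main.
elim: k rho => [|k IHk] rho le_rho prho.
  apply: fixed => // S1 S2; move: le_rho; rewrite leqn0 cards_eq0 => /eqP->.
  by rewrite inE.
rewrite iterSr /adj_merge; case: pickP => [[S1 S2]|none] /=.
  case/and3P=> i1 i2 adj; have neS := adjacent_neq adj.
  have [||pQ sQ aQ] := IHk ((S1 :|: S2) |: (rho :\ S1 :\ S2)).
  - rewrite -ltnS; apply: leq_trans le_rho.
    rewrite (cardsD1 S1 rho) i1 add1n ltnS (cardsD1 S2 (rho :\ S1)).
    rewrite !inE eq_sym neS i2 /= cardsU1 leq_add2r.
    by case: (_ \notin _).
  - exact: merge_partition.
  - split=> // [p /sQ|p pin Z x sZ]; first by rewrite merge_stable.
    by apply: aQ => //; rewrite merge_stable.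
have fix_rho : adj_merge rho = rho.
  by rewrite /adj_merge; case: pickP => // s; rewrite none.
rewrite -/(@adj_merge n) iter_fix //; apply: fixed => // S1 S2 S1in S2in.
by have /= := none (S1, S2); rewrite S1in S2in /= => ->.
Qed.

Lemma partitionU D1 D2 pi1 pi2 :
  partition pi1 D1 -> partition pi2 D2 -> [disjoint D1 & D2] ->
  partition (pi1 :|: pi2) (D1 :|: D2).
Proof.
move=> p1 p2 dD; apply: partition_intro.
- by move=> B /setUP[/(partition_sub p1)|/(partition_sub p2)] sB;
    rewrite (subset_trans sB) ?subsetUl ?subsetUr.
- by move=> x /setUP[/(partition_mem p1)|/(partition_mem p2)] [B Bi xB];
    exists B; rewrite // inE Bi ?orbT.
- have cross B B' x : B \in pi1 -> B' \in pi2 -> x \in B -> x \in B' -> B = B'.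
    move=> /(partition_sub p1)/subsetP s1 /(partition_sub p2)/subsetP s2.
    by move=> /s1 x1 /s2 x2; case/pred0P/(_ x)/andP: dD.
  move=> B B' /setUP[i|i] /setUP[i'|i'] x xB xB'.
  + exact: partition_in_eq p1 i i' xB xB'.
  + exact: cross xB xB'.
  + exact/esym/(cross _ _ _ i' i xB' xB).
  + exact: partition_in_eq p2 i i' xB xB'.
- by move=> B /setUP[/(partition_nonempty p1)|/(partition_nonempty p2)].
Qed.

Lemma adjacentI B1 B2 b c :
  is_max b B1 -> is_min c B2 -> c = b.+1 :> nat -> adjacent B1 B2.
Proof.
move=> mb mc e; apply/existsP; exists b; apply/existsP; exists c.
by rewrite mb mc e eqxx.
Qed.

Lemma stableS pi pi' Z : pi \subset pi' -> stable pi' Z -> stable pi Z.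
Proof.
move/subsetP=> sub [sat lnk]; split=> [B /sub|B1 B2 /sub i1 /sub i2].
  exact: sat.
exact: lnk.
Qed.

(** A set that is stable on one side stays stable in the union, as no link
crosses; hence the components of both sides are components of the union. *)
Lemma adj_closureU D1 D2 pi1 pi2 :
  partition pi1 D1 -> partition pi2 D2 -> [disjoint D1 & D2] ->
  {in pi1 & pi2, forall B1 B2, ~~ adjacent B1 B2 /\ ~~ adjacent B2 B1} ->
  adj_closure (pi1 :|: pi2) = adj_closure pi1 :|: adj_closure pi2.
Proof.
move=> p1 p2 dD nadj.
apply: components_uniq (closure_components (partitionU p1 p2 dD)) _.
have [pQ1 sQ1 aQ1] := closure_components p1.
have [pQ2 sQ2 aQ2] := closure_components p2.
have ext E1 E2 rho1 rho2 (q : {set 'I_n}) :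
    partition rho1 E1 -> partition rho2 E2 ->
    [disjoint E1 & E2] -> q \subset E1 -> stable rho1 q ->
    {in rho1 & rho2, forall B1 B2, ~~ adjacent B1 B2 /\ ~~ adjacent B2 B1} ->
    stable (rho1 :|: rho2) q.
  move=> r1 r2 dE /subsetP qE [sat lnk] nad.
  have outq B x : B \in rho2 -> x \in B -> (x \in q) = false.
    move=> /(partition_sub r2)/subsetP sB /sB xE2.
    by apply/negP=> /qE xE1; case/pred0P/(_ x)/andP: dE.
  split=> [B /setUP[Bi|Bi] x y xB yB|B1 B2 i1 i2 b c mb mc e].
  - exact: (sat B).
  - by rewrite !(outq B).
  - have [bB _] := is_maxP _ _ mb; have [cB _] := is_minP _ _ mc.
    have adj := adjacentI mb mc e.
    case/setUP: i1 => i1; case/setUP: i2 => i2.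
    + exact: (lnk B1 B2).
    + by case: (nad _ _ i1 i2); rewrite adj.
    + by case: (nad _ _ i2 i1); rewrite adj.
    + by rewrite (outq B1) ?(outq B2).
split; first exact: partitionU.
- move=> p /setUP[pi|pi].
    by apply: (ext D1 D2) => //; [apply: (partition_sub pQ1)|apply: sQ1].
  rewrite setUC; apply: (ext D2 D1) => //; first by rewrite disjoint_sym.
  + exact: (partition_sub pQ2).
  + exact: sQ2.
  + by move=> B1 B2 i1 i2; case: (nadj _ _ i2 i1).
- move=> p /setUP[pi|pi] Z x sZ xp xZ.
    by apply: (aQ1 _ pi _ x) => //; apply: stableS sZ; apply: subsetUl.
  by apply: (aQ2 _ pi _ x) => //; apply: stableS sZ; apply: subsetUr.
Qed.

Definition linked D pi : Prop :=
  forall Z, stable pi Z -> {in D &, forall x y, (x \in Z) = (y \in Z)}.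

Lemma adj_closure_linked D pi :
  partition pi D -> linked D pi -> D != set0 -> adj_closure pi = [set D].
Proof.
move=> ppi lnk /set0Pn[x0 x0D].
have [pQ sQ _] := closure_components ppi.
have full : {in adj_closure pi, forall p, p = D}.
  move=> p pin; apply/eqP; rewrite eqEsubset (partition_sub pQ pin) /=.
  have [x xp] := partition_nonempty pQ pin; apply/subsetP=> y yD.
  by rewrite (lnk p (sQ _ pin) y x) // (subsetP (partition_sub pQ pin)).
have [p pin _] := partition_mem pQ x0D.
apply/setP=> q; rewrite inE; apply/idP/eqP => [/full //|->].
by rewrite -(full p pin).
Qed.

(** The outer blocks met while reading an interval from left to right up to
position [a]: they are in one class of the closure, and the next block, which
starts at [a], will join it. *)
Definition tower a D T : Prop :=
  [/\ partition T D, {in D, forall x : 'I_n, x < a}, linked D T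
    & T = set0 \/ exists B b, [/\ B \in T, is_max b B & a = b.+1]].

Lemma tower0 a : tower a set0 set0.
Proof.
split; [by rewrite partition_set0|by move=> x; rewrite inE| |by left].
by move=> Z _ x y; rewrite inE.
Qed.

Lemma partition1 S : S != set0 -> partition [set S] S.
Proof.
move=> /set0Pn[x xS]; apply: partition_intro.
- by move=> B /set1P->.
- by move=> y yS; exists S; rewrite ?inE.
- by move=> B B' /set1P-> /set1P->.
- by move=> B /set1P->; exists x.
Qed.

(** The maximum of the topmost block of [T] is linked to the minimum of [S], so
[S] joins the class formed by [T]. *)
Lemma tower_cons a D T S x y :
  tower a D T -> is_min x S -> x = a :> nat -> is_max y S ->
  tower y.+1 (S :|: D) (S |: T).
Proof.
case=> pT ltD lnk top mx ea my.
have [xS ge_x] := is_minP _ _ mx; have [yS le_y] := is_maxP _ _ my.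
split.
- apply: partitionU => //; first by apply: partition1; apply/set0Pn; exists x.
  apply/pred0P=> z /=; apply/negP=> /andP[/ge_x + /ltD]; rewrite ea; lia.
- by move=> z /setUP[/le_y //|/ltD]; move: (ge_x y yS); rewrite ea; lia.
- move=> Z sZ; have sTZ : stable T Z by apply: stableS sZ; apply: subsetUr.
  suff toZ : {in S :|: D, forall z, (z \in Z) = (x \in Z)}.
    by move=> z t zD tD; rewrite !toZ.
  case: (sZ) => sat link z /setUP[zS|zD].
    by apply: (sat S); rewrite ?setU11.
  case: top => [T0|[B [b [BT mb eb]]]].
    by case/(partition_mem pT): zD => B; rewrite T0 inE.
  have [bB _] := is_maxP _ _ mb.
  rewrite (lnk Z sTZ z b) //; last exact: (subsetP (partition_sub pT BT)).
  by apply: (link B S); rewrite ?setU11 ?setU1r // ea.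
- by right; exists S, y; rewrite setU11.
Qed.

Local Open Scope ring_scope.

(** The closure weight for an arbitrary sequence instead of the Catalan numbers,
with values in any ring, so that it can be multiplied by block variables. *)
Definition omega (R : comNzRingType) (w : nat -> R) pi : R :=
  \prod_(p in adj_closure pi) w #|[set B in pi | B \subset p]|.

Lemma omegaU (R : comNzRingType) (w : nat -> R) D1 D2 pi1 pi2 :
  partition pi1 D1 -> partition pi2 D2 -> [disjoint D1 & D2] ->
  {in pi1 & pi2, forall B1 B2, ~~ adjacent B1 B2 /\ ~~ adjacent B2 B1} ->
  omega w (pi1 :|: pi2) = omega w pi1 * omega w pi2.
Proof.
move=> p1 p2 dD nadj; rewrite /omega (adj_closureU p1 p2) //.
have [pQ1 _ _] := closure_components p1.
have [pQ2 _ _] := closure_components p2.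
have noin E1 E2 rho1 rho2 (B q : {set 'I_n}) :
    partition rho1 E1 -> partition rho2 E2 ->
    [disjoint E1 & E2] -> B \in rho2 -> q \in rho1 -> ~~ (B \subset q).
  move=> r1 r2 dE Bi qi; have [x xB] := partition_nonempty r2 Bi.
  apply/negP=> /subsetP/(_ x xB) xq; case/pred0P/(_ x)/andP: dE; split.
    exact: (subsetP (partition_sub r1 qi)).
  exact: (subsetP (partition_sub r2 Bi)).
rewrite prod_setU; last first.
  apply/pred0P=> q /=; apply/negP=> /andP[q1 q2].
  by case/negP: (noin _ _ _ _ q q pQ1 pQ2 dD q2 q1).
congr (_ * _); apply: eq_bigr => p pin; congr (w #|pred_of_set _|); apply/setP=> B.
  rewrite !inE andb_orl; case: (boolP (B \in pi2)) => [Bi|]; last by rewrite orbF.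
  by rewrite (negbTE (noin _ _ _ _ B p pQ1 p2 dD Bi pin)) !andbF.
rewrite !inE andb_orl; case: (boolP (B \in pi1)) => [Bi|//] /=.
rewrite disjoint_sym in dD.
by rewrite (negbTE (noin _ _ _ _ B p pQ2 p1 dD Bi pin)) !andbF.
Qed.

Lemma omega_tower (R : comNzRingType) (w : nat -> R) a D T :
  w 0%N = 1 -> tower a D T -> omega w T = w #|T|.
Proof.
move=> w0 [pT _ lnk _]; have [D0|nD] := eqVneq D set0.
  have -> : T = set0.
    apply/setP=> B; rewrite [RHS]inE; apply/negP=> Bi.
    have [x] := partition_nonempty pT Bi.
    by move/(subsetP (partition_sub pT Bi)); rewrite D0 inE.
  by rewrite /omega /adj_closure cards0 /= big_set0 w0.
rewrite /omega (adj_closure_linked pT lnk nD) big_set1; congr (w #|pred_of_set _|).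
apply/setP=> B; rewrite !inE andbC.
by case: (boolP (B \in T)) => [/(partition_sub pT)->|]; rewrite ?andbF.
Qed.

Local Close Scope ring_scope.

(** * Noncrossing partitions of a set with holes *)

(** The sets [D] below arise from an interval by removing a block, and a block
of a noncrossing partition may not pass over a removed element. *)
Definition gap_closed D B : bool :=
  [forall x in B, forall y in B, forall z : 'I_n, (x < z < y) ==> (z \in D)].

Definition good D pi : bool :=
  [&& partition pi D, noncrossing pi & [forall B in pi, gap_closed D B]].

Lemma gap_closedP D B : reflect
  {in B &, forall x y z : 'I_n, x < z -> z < y -> z \in D} (gap_closed D B).
Proof.
apply: (iffP forall_inP) => h x.
  move=> y xB yB z lxz lzy; have /forall_inP/(_ y yB)/forallP/(_ z) := h x xB.
  by rewrite lxz lzy.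
move=> xB; apply/forall_inP=> y yB; apply/forallP=> z; apply/implyP=> /andP[].
exact: h.
Qed.

Lemma noncrossingP pi : reflect
  (forall (P Q : {set 'I_n}), P \in pi -> Q \in pi ->
     forall a b c d : 'I_n, P != Q -> a \in P -> b \in Q -> c \in P ->
     d \in Q -> a < b -> b < c -> c < d -> False) (noncrossing pi).
Proof.
apply: (iffP forall_inP) => h P.
  move=> Q Pi Qi a b c d neq aP bQ cP dQ ab bc cd.
  have /forall_inP/(_ Q Qi)/implyP/(_ neq) := h P Pi.
  move/forall_inP/(_ a aP)/forall_inP/(_ b bQ)/forall_inP/(_ c cP).
  by move/forall_inP/(_ d dQ); rewrite ab bc cd.
move=> Pi; apply/forall_inP=> Q Qi; apply/implyP=> neq.
apply/forall_inP=> a aP; apply/forall_inP=> b bQ; apply/forall_inP=> c cP.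
by apply/forall_inP=> d dQ; apply/negP=> /and3P[]; apply: (h P Q Pi Qi a b c d).
Qed.

Lemma goodP D pi : reflect [/\ partition pi D, noncrossing pi &
  {in pi, forall B, gap_closed D B}] (good D pi).
Proof. by apply: (iffP and3P) => -[? ? /forall_inP]. Qed.

(** As [a] precedes everything in [D], a block passing over an element [z] of
[S] would cross [S] at [a < x < z < y]. *)
Lemma good_rem D pi S (a : 'I_n) : {in D, forall x : 'I_n, a <= x} ->
  good D pi -> S \in pi -> a \in S -> good (D :\: S) (pi :\ S).
Proof.
move=> amin /goodP[pD /noncrossingP nc gc] Si aS.
have rem B : B \in pi :\ S -> B != S /\ B \in pi by move/setD1P.
have out B x : B \in pi :\ S -> x \in B -> x \notin S.
  move/rem=> [nB Bi] xB.
  by apply: contra nB => /(partition_in_eq pD Bi Si xB) ->.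
apply/goodP; split.
- apply: partition_intro.
  + move=> B Bi; apply/subsetP=> x xB; rewrite inE (out B) //.
    by case/rem: Bi => _ /(partition_sub pD)/subsetP->.
  + move=> x /setDP[/(partition_mem pD)[B Bi xB] nS]; exists B; rewrite // !inE Bi.
    by rewrite andbT; apply: contraNneq nS => <-.
  + by move=> B B' /rem[_ i] /rem[_ i'] x; apply: partition_in_eq pD i i'.
  + by move=> B /rem[_ /(partition_nonempty pD)].
- by apply/noncrossingP=> P Q /rem[_ Pi] /rem[_ Qi]; apply: nc.
- move=> B Bi; apply/gap_closedP=> x y xB yB z xz zy.
  have [nB Bpi] := rem _ Bi; have xD := subsetP (partition_sub pD Bpi) _ xB.
  rewrite inE (gap_closedP _ _ (gc _ Bpi) x y) // andbT; apply/negP=> zS.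
  apply: (nc S B Si Bpi a x z y) => //; first by rewrite eq_sym.
  have := amin x xD; rewrite leq_eqVlt => /orP[/eqP/val_inj ax|//].
  by case/negP: (out _ _ Bi xB); rewrite -ax.
Qed.

(** In a crossing of [S] with a block of [s], whichever starts first, the block
of [s] passes over an element of [S], which [gap_closed] excludes. *)
Lemma good_cons D s S : S != set0 -> S \subset D -> gap_closed D S ->
  good (D :\: S) s -> good D (S |: s) /\ S \notin s.
Proof.
move=> nS SD /gap_closedP gS /goodP[pD /noncrossingP nc gc].
have dS : [disjoint S & D :\: S].
  by apply/pred0P=> x /=; rewrite inE; case: (x \in S).
have out B x : B \in s -> x \in B -> x \notin S.
  by move=> Bs /(subsetP (partition_sub pD Bs)) /setDP[].
have gap B (x y z : 'I_n) : B \in s -> x \in B -> y \in B -> x < z -> z < y ->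
    (z \in D) && (z \notin S).
  move=> Bs xB yB xz zy.
  by have := gap_closedP _ _ (gc B Bs) x y xB yB z xz zy; rewrite inE andbC.
split; last first.
  by case/set0Pn: nS => x xS; apply/negP=> /out/(_ xS); rewrite xS.
apply/goodP; split.
- have -> : D = S :|: (D :\: S).
    apply/setP=> x; rewrite !inE; case: (boolP (x \in S)) => //=.
    exact: (subsetP SD).
  by apply: partitionU pD dS; apply: partition1.
- apply/noncrossingP=> P Q /setU1P[->|Pi] /setU1P[->|Qi] a b c d neq aP bQ cP dQ.
  + by rewrite eqxx in neq.
  + by move=> _ bc cd; case/andP: (gap _ _ _ _ Qi bQ dQ bc cd); rewrite cP.
  + by move=> ab bc _; case/andP: (gap _ _ _ _ Pi aP cP ab bc); rewrite bQ.
  + exact: (nc P Q Pi Qi a b c d).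
- move=> B /setU1P[->|Bi]; apply/gap_closedP => // x y xB yB z xz zy.
  by case/andP: (gap _ _ _ _ Bi xB yB xz zy).
Qed.

Lemma sum_good_peel (V : nmodType) D (a : 'I_n) (F : {set {set 'I_n}} -> V) :
  a \in D -> {in D, forall x : 'I_n, a <= x} ->
  (\sum_(pi | good D pi) F pi =
  \sum_(S : {set 'I_n} | [&& a \in S, S \subset D & gap_closed D S])
    \sum_(s | good (D :\: S) s) F (S |: s))%R.
Proof.
move=> aD amin; rewrite pair_big_dep /=.
rewrite (reindex_onto (fun q : {set 'I_n} * {set {set 'I_n}} => q.1 |: q.2)
  (fun pi => (pblock pi a, pi :\ pblock pi a))) /=; last first.
  move=> pi /goodP[/and3P[/eqP cD _ _] _ _].
  by rewrite setD1K // pblock_mem // cD.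
apply: eq_bigl => -[S s] /=; apply/andP/idP.
  case=> gD /eqP[eS es]; have [pD _ gc] := goodP _ _ gD.
  have [/eqP cD _ _] := and3P pD.
  have aS : a \in S by rewrite -eS mem_pblock cD.
  rewrite aS (partition_sub pD) ?setU11 // gc ?setU11 //=.
  by rewrite -es eS; apply: good_rem aS => //; rewrite setU11.
case/andP=> /and3P[aS SD gS] gs.
have nS : S != set0 by apply/set0Pn; exists a.
have [gD Ss] := good_cons nS SD gS gs.
have [/and3P[_ tI _] _ _] := goodP _ _ gD.
have eS : pblock (S |: s) a = S by apply: (def_pblock tI); rewrite ?setU11.
by split=> //; rewrite eS; apply/eqP; congr pair; rewrite setU1K.
Qed.

(** A block meeting both sides would pass over [z], which is not in the set. *)
Lemma good_partsub D1 D2 z pi :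
  {in D1, forall x : 'I_n, x < z} -> {in D2, forall x : 'I_n, z < x} ->
  good (D1 :|: D2) pi -> {in pi, forall B, B \subset D1 \/ B \subset D2}.
Proof.
move=> lt1 gt2 /goodP[pD _ gc] B Bi.
have inD x : x \in B -> x \in D1 \/ x \in D2.
  by move/(subsetP (partition_sub pD Bi))/setUP.
have [x xB] := partition_nonempty pD Bi.
have cross (u v : 'I_n) : u \in B -> v \in B -> u \in D1 -> v \in D2 -> False.
  move=> uB vB u1 v2; have [lz zl] := (lt1 _ u1, gt2 _ v2).
  pose z' : 'I_n := Ordinal (ltn_trans zl (ltn_ord v)).
  have := gap_closedP _ _ (gc B Bi) u v uB vB z' lz zl.
  by case/setUP=> [/lt1|/gt2] /=; rewrite ltnn.
case: (inD _ xB) => xD; [left|right]; apply/subsetP=> y yB.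
  by case: (inD _ yB) => // yD; case: (cross x y).
by case: (inD _ yB) => // yD; case: (cross y x).
Qed.

Lemma good_restrict D (E : {set 'I_n}) pi : good D pi ->
  {in pi, forall B, B \subset E \/ [disjoint B & E]} -> E \subset D ->
  (forall (B : {set 'I_n}), B \in pi -> forall x y z : 'I_n, B \subset E ->
     x \in B -> y \in B -> x < z -> z < y -> z \in D -> z \in E) ->
  good E [set B in pi | B \subset E].
Proof.
move=> /goodP[pD /noncrossingP nc gc] dich ED conv.
have res B : B \in [set B in pi | B \subset E] -> B \in pi /\ B \subset E.
  by rewrite inE => /andP.
apply/goodP; split.
- apply: partition_intro.
  + by move=> B /res[].
  + move=> x xE; have [B Bi xB] := partition_mem pD (subsetP ED _ xE).
    exists B; rewrite // inE Bi /=; case: (dich B Bi) => //.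
    by move/pred0P/(_ x); rewrite /= xB xE.
  + by move=> B B' /res[i _] /res[i' _] x; apply: partition_in_eq pD i i'.
  + by move=> B /res[/(partition_nonempty pD)].
- by apply/noncrossingP=> P Q /res[Pi _] /res[Qi _]; apply: nc.
- move=> B /res[Bi BE]; apply/gap_closedP=> x y xB yB z xz zy.
  by apply: (conv B Bi x y) => //; apply: (gap_closedP _ _ (gc B Bi) x y).
Qed.

Lemma goodU D1 D2 z s1 s2 :
  {in D1, forall x : 'I_n, x < z} -> {in D2, forall x : 'I_n, z < x} ->
  good D1 s1 -> good D2 s2 -> good (D1 :|: D2) (s1 :|: s2).
Proof.
move=> lt1 gt2 /goodP[p1 /noncrossingP nc1 gc1] /goodP[p2 /noncrossingP nc2 gc2].
have lt B B' (x y : 'I_n) : B \in s1 -> B' \in s2 -> x \in B -> y \in B' -> x < y.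
  move=> /(partition_sub p1)/subsetP sB /(partition_sub p2)/subsetP sB'.
  by move=> /sB/lt1 xz /sB'/gt2; apply: ltn_trans.
apply/goodP; split.
- apply: partitionU => //; apply/pred0P=> x /=; apply/negP=> /andP[/lt1 + /gt2].
  by move=> xz zx; have := ltn_trans xz zx; rewrite ltnn.
- apply/noncrossingP=> P Q /setUP[Pi|Pi] /setUP[Qi|Qi] a b c d neq aP bQ cP dQ.
  + exact: (nc1 P Q Pi Qi a b c d).
  + by move=> _ bc _; have := lt _ _ _ _ Pi Qi cP bQ; rewrite ltnNge ltnW.
  + by move=> ab _ _; have := lt _ _ _ _ Qi Pi bQ aP; rewrite ltnNge ltnW.
  + exact: (nc2 P Q Pi Qi a b c d).
- move=> B /setUP[Bi|Bi]; apply/gap_closedP=> x y xB yB w xw wy; rewrite inE.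
    by rewrite (gap_closedP _ _ (gc1 B Bi) x y).
  by rewrite (gap_closedP _ _ (gc2 B Bi) x y) ?orbT.
Qed.

(** This independence of the two sides is what turns gaps into factors. *)
Lemma sum_good_split (V : nmodType) D1 D2 z (F : {set {set 'I_n}} -> V) :
  {in D1, forall x : 'I_n, x < z} -> {in D2, forall x : 'I_n, z < x} ->
  (\sum_(pi | good (D1 :|: D2) pi) F pi =
  \sum_(s1 | good D1 s1) \sum_(s2 | good D2 s2) F (s1 :|: s2))%R.
Proof.
move=> lt1 gt2; rewrite pair_big_dep /=.
have dD x : x \in D1 -> x \in D2 -> False.
  by move=> /lt1 xz /gt2 zx; have := ltn_trans xz zx; rewrite ltnn.
have dis B : B \subset D1 -> B \subset D2 -> B = set0.
  move=> /subsetP s1 /subsetP s2; apply/setP=> x; rewrite inE.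
  by apply/negP=> xB; apply: (dD x); [apply: s1|apply: s2].
rewrite (reindex_onto (fun q : {set {set 'I_n}} * {set {set 'I_n}} => q.1 :|: q.2)
  (fun pi => ([set B in pi | B \subset D1], [set B in pi | B \subset D2]))) /=; last first.
  move=> pi gpi; apply/setP=> B; rewrite !inE.
  case: (boolP (B \in pi)) => //= Bi.
  by case: (good_partsub lt1 gt2 gpi Bi) => ->; rewrite ?orbT.
have sep s1 s2 : good D1 s1 -> good D2 s2 ->
    [set B in s1 :|: s2 | B \subset D1] = s1.
  move=> /goodP[p1 _ _] /goodP[p2 _ _]; apply/setP=> B; rewrite !inE.
  apply/idP/idP => [/andP[/orP[//|Bi] B1]|Bi]; last first.
    by rewrite Bi (partition_sub p1 Bi).
  have [x] := partition_nonempty p2 Bi.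
  by rewrite (dis B B1 (partition_sub p2 Bi)) inE.
have sep' s1 s2 : good D1 s1 -> good D2 s2 ->
    [set B in s1 :|: s2 | B \subset D2] = s2.
  move=> /goodP[p1 _ _] /goodP[p2 _ _]; apply/setP=> B; rewrite !inE.
  apply/idP/idP => [/andP[/orP[Bi|//] B2]|Bi]; last first.
    by rewrite Bi (partition_sub p2 Bi) orbT.
  have [x] := partition_nonempty p1 Bi.
  by rewrite (dis B (partition_sub p1 Bi) B2) inE.
apply: eq_bigl => -[s1 s2] /=; apply/andP/andP; last first.
  case=> g1 g2; split; first exact: goodU lt1 gt2 g1 g2.
  by rewrite (sep s1 s2) // (sep' s1 s2).
case=> gD /eqP[e1 e2].
have dich := good_partsub lt1 gt2 gD.
have convD (x y w : 'I_n) : x < w -> w < y -> w \in D1 :|: D2 ->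
    (y \in D1 -> w \in D1) /\ (x \in D2 -> w \in D2).
  move=> xw wy /setUP[wD|wD]; split=> // h.
    by have := lt1 _ wD; have := gt2 _ h; lia.
  by have := lt1 _ h; have := gt2 _ wD; lia.
split; [rewrite -e1|rewrite -e2]; apply: good_restrict gD _ _ _.
- move=> B /dich[]; auto => B2; right; apply/pred0P=> x /=.
  by apply/negP=> /andP[/(subsetP B2) x2 x1]; apply: (dD x).
- exact: subsetUl.
- move=> B Bi x y w B1 xB yB xw wy wD; case: (convD x y w xw wy wD) => h _.
  by apply: h; apply: (subsetP B1).
- move=> B /dich[]; auto => B1; right; apply/pred0P=> x /=.
  by apply/negP=> /andP[/(subsetP B1) x1 x2]; apply: (dD x).
- exact: subsetUr.
- move=> B Bi x y w B2 xB yB xw wy wD; case: (convD x y w xw wy wD) => _ h.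
  by apply: h; apply: (subsetP B2).
Qed.

End Closure.
(** * Recursions for the weighted sums *)

Local Open Scope ring_scope.

Section WeightedSums.

Variables (n : nat) (R : comNzRingType) (w t : nat -> R).
Hypothesis w0 : w 0%N = 1.

Implicit Types (D S B : {set 'I_n}) (pi : {set {set 'I_n}}) (x y e : 'I_n).

Definition size_weight pi : R := \prod_(B in pi) t #|B|.

Definition wsum D : R := \sum_(pi | good D pi) omega w pi * size_weight pi.

Definition itv (a b : nat) : {set 'I_n} := [set x : 'I_n | a <= x < b]%N.

Lemma size_weightU D1 D2 pi1 pi2 :
  partition pi1 D1 -> partition pi2 D2 -> [disjoint D1 & D2] ->
  size_weight (pi1 :|: pi2) = size_weight pi1 * size_weight pi2.
Proof.
move=> p1 p2 dD; rewrite /size_weight prod_setU //.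
apply/pred0P=> B /=; apply/negP=> /andP[i1 i2].
have [x xB] := partition_nonempty p1 i1; case/pred0P/(_ x)/andP: dD.
by split; [apply: (subsetP (partition_sub p1 i1))|
           apply: (subsetP (partition_sub p2 i2))].
Qed.

Lemma disjoint_lt_gt D1 D2 (z : nat) :
  {in D1, forall x, x < z}%N -> {in D2, forall x, z < x}%N -> [disjoint D1 & D2].
Proof.
move=> lt1 gt2; apply/pred0P=> x /=; apply/negP=> /andP[/lt1 xz /gt2 zx].
by have := ltn_trans xz zx; rewrite ltnn.
Qed.

Lemma wsumU D1 D2 (z : nat) :
  {in D1, forall x, x < z}%N -> {in D2, forall x, z < x}%N ->
  wsum (D1 :|: D2) = wsum D1 * wsum D2.
Proof.
move=> lt1 gt2; rewrite /wsum (sum_good_split _ lt1 gt2) mulr_suml.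
apply: eq_bigr => s1 /goodP[p1 _ _]; rewrite mulr_sumr.
apply: eq_bigr => s2 /goodP[p2 _ _].
have dD := disjoint_lt_gt lt1 gt2.
rewrite (omegaU _ p1 p2) // ?(size_weightU p1 p2) // 1?mulrACA // => B1 B2 i1 i2.
have sub1 := subsetP (partition_sub p1 i1).
have sub2 := subsetP (partition_sub p2 i2).
split; apply/existsP=> -[b /existsP[c /and3P[/is_maxP[bi _] /is_minP[ci _] /eqP]]].
  by have := lt1 _ (sub1 _ bi); have := gt2 _ (sub2 _ ci); lia.
by have := lt1 _ (sub1 _ ci); have := gt2 _ (sub2 _ bi); lia.
Qed.

Lemma good0 pi : good set0 pi = (pi == set0).
Proof.
apply/idP/eqP => [/goodP[]|->]; first by rewrite partition_set0 => /eqP.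
apply/goodP; split; first by rewrite partition_set0.
  by apply/noncrossingP => P Q; rewrite inE.
by move=> B; rewrite inE.
Qed.

Lemma wsum0 : wsum set0 = 1.
Proof.
rewrite /wsum (eq_bigl _ _ good0) big_pred1_eq (omega_tower w0 (tower0 n 0)).
by rewrite cards0 w0 /size_weight big_set0 mulr1.
Qed.

Lemma max_exists S : S != set0 -> exists y, is_max y S.
Proof.
case/set0Pn=> x xS; case: (arg_maxnP (fun y => y : nat) xS) => y yS le_y.
by exists y; apply/is_maxP.
Qed.

Lemma min_exists S : S != set0 -> exists y, is_min y S.
Proof.
case/set0Pn=> x xS; case: (arg_minnP (fun y => y : nat) xS) => y yS le_y.
by exists y; apply/is_minP.
Qed.

Lemma sum_by_max (P : pred {set 'I_n}) (F : {set 'I_n} -> R) :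
  {in P, forall S, S != set0} ->
  \sum_(S | P S) F S = \sum_y \sum_(S | P S && is_max y S) F S.
Proof.
move=> nz; rewrite (exchange_big_dep P) //=; last by move=> y S _ /andP[].
apply: eq_bigr => S PS; have [y my] := max_exists (nz _ PS).
rewrite (big_pred1 y) // => z; rewrite PS /=; apply/idP/eqP => [mz|->//].
have [[yS le_y] [zS le_z]] := (is_maxP _ _ my, is_maxP _ _ mz).
by apply/val_inj/eqP; rewrite /= eqn_leq le_y ?le_z.
Qed.

Lemma sum_by_min (P : pred {set 'I_n}) (F : {set 'I_n} -> R) :
  {in P, forall S, S != set0} ->
  \sum_(S | P S) F S = \sum_y \sum_(S | P S && is_min y S) F S.
Proof.
move=> nz; rewrite (exchange_big_dep P) //=; last by move=> y S _ /andP[].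
apply: eq_bigr => S PS; have [y my] := min_exists (nz _ PS).
rewrite (big_pred1 y) // => z; rewrite PS /=; apply/idP/eqP => [mz|->//].
have [[yS le_y] [zS le_z]] := (is_minP _ _ my, is_minP _ _ mz).
by apply/val_inj/eqP; rewrite /= eqn_leq le_y ?le_z.
Qed.

(** The contribution of one outer block filling the positions from [x] to [y],
with everything in its gaps. The weight [u] of the block is left free, since
removing the first element of the block shifts it. *)
Definition block_sum (u : nat -> R) x y : R :=
  \sum_(S | is_min x S && is_max y S) u #|S| * wsum (itv x y.+1 :\: S).

(** The blocks of [T] have been read before position [a]; they enter the closure
weight only. *)
Definition chain_sum (a b : nat) (T : {set {set 'I_n}}) : R :=
  \sum_(pi | good (itv a b) pi) omega w (T :|: pi) * size_weight pi.

Lemma block_sum1 u x : block_sum u x x = u 1%N.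
Proof.
rewrite /block_sum (big_pred1 [set x]) => [|S].
  rewrite cards1 (_ : _ :\: _ = set0) ?wsum0 ?mulr1 //.
  by apply/setP=> z; rewrite !inE -val_eqE /=; lia.
apply/andP/eqP => [[/is_minP[xS ge_x] /is_maxP[_ le_x]]|->].
  apply/setP=> z; rewrite inE; apply/idP/eqP => [zS|-> //].
  by apply/val_inj/eqP; rewrite /= eqn_leq ge_x // le_x.
split; [apply/is_minP|apply/is_maxP]; split; rewrite ?inE // => z;
  by rewrite inE => /eqP->.
Qed.

(** Here [e] is the second element of the block: the gap between [x] and [e]
separates from the rest. *)
Lemma block_sum_step u x y : (x < y)%N ->
  block_sum u x y = \sum_(e : 'I_n | (x < e <= y)%N)
    wsum (itv x.+1 e) * block_sum (fun k => u k.+1) e y.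
Proof.
move=> xy; rewrite /block_sum.
rewrite (reindex_onto (fun S => x |: S) (fun S => S :\ x)) /=; last first.
  by move=> S /andP[/is_minP[xS _] _]; rewrite setD1K.
transitivity (\sum_(S | is_max y S && (S \subset itv x.+1 n))
    u #|S|.+1 * wsum (itv x y.+1 :\: (x |: S))).
  apply: eq_big => S; last first.
    case/andP=> _ /eqP eS; have xS : x \notin S by rewrite -eS !inE eqxx.
    by rewrite cardsU1 xS.
  apply/idP/idP.
    case/andP=> /andP[/is_minP[_ ge_x] /is_maxP[yi le_y]] /eqP eS.
    have xS : x \notin S by rewrite -eS !inE eqxx.
    apply/andP; split.
      apply/is_maxP; split; last by move=> z zS; apply: le_y; rewrite setU1r.
      by case/setU1P: yi => // yx; rewrite yx ltnn in xy.
    apply/subsetP=> z zS; rewrite inE ltn_ord andbT ltn_neqAle ge_x ?setU1r //.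
    by rewrite andbT val_eqE; apply: contraNneq xS => ->.
  case/andP=> /is_maxP[yS le_y] /subsetP sS.
  have xS : x \notin S by apply/negP=> /sS; rewrite inE ltnn.
  rewrite setU1K // eqxx andbT; apply/andP; split.
    apply/is_minP; split=> [|z /setU1P[-> //|/sS]]; first exact: setU11.
    by rewrite inE => /andP[/ltnW].
  apply/is_maxP; split=> [|z /setU1P[->|/le_y //]]; first exact: setU1r.
  exact: ltnW.
rewrite sum_by_min; last first.
  by move=> S /andP[/is_maxP[yS _] _]; apply/set0Pn; exists y.
rewrite [RHS]big_mkcond /=; apply: eq_bigr => e _.
case: ifPn => [/andP[xe ey]|nxey]; last first.
  rewrite big1 // => S /andP[/andP[/is_maxP[_ le_y] /subsetP sS] /is_minP[eS _]].
  case/negP: nxey; rewrite le_y // andbT.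
  by have := sS e eS; rewrite inE => /andP[].
rewrite mulr_sumr; apply: eq_big => S.
  rewrite andbC; case: (boolP (is_min e S)) => [/is_minP[eS ge_e]|//] /=.
  case: (boolP (is_max y S)) => //= _; apply/subsetP=> z /ge_e ez.
  by rewrite inE ltn_ord andbT; apply: leq_trans ez.
case/andP=> /andP[/is_maxP[yS le_y] _] /is_minP[eS ge_e].
rewrite mulrCA; congr (_ * _).
rewrite -(@wsumU _ _ e); first congr wsum.
- apply/setP=> z; rewrite !inE -val_eqE /=.
  case: (boolP (z \in S)) => [/ge_e|_]; rewrite ?orbT ?orbF /=; lia.
- by move=> z; rewrite inE => /andP[].
- move=> z /setDP[]; rewrite inE => /andP[ez _] zS.
  by rewrite ltn_neqAle ez andbT val_eqE; apply: contraNneq zS => <-.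
Qed.

(** Here [S] is the block of [x] and [y] its maximum. What lies in the gaps of
[S] is adjacent neither to [S] nor to [T] nor to what follows [y], so it
contributes a separate factor, while [S] itself is added to the chain [T]. *)
Lemma chain_sum_step x b D (T : {set {set 'I_n}}) : (x < b)%N -> tower x D T ->
  chain_sum x b T = \sum_(y : 'I_n | (x <= y < b)%N)
    \sum_(S | is_min x S && is_max y S)
       t #|S| * wsum (itv x y.+1 :\: S) * chain_sum y.+1 b (S |: T).
Proof.
move=> xb tw; have [pT ltD _ _] := tw; rewrite /chain_sum (@sum_good_peel _ _ _ x).
- rewrite sum_by_max; last first.
    by move=> S /and3P[xS _ _]; apply/set0Pn; exists x.
  rewrite [RHS]big_mkcond /=; apply: eq_bigr => y _.
  case: ifPn => [/andP[xy yb]|nxyb]; last first.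
    rewrite big1 // => S /andP[/and3P[_ /subsetP sS _] /is_maxP[yS _]].
    by case/negP: nxyb; have := sS y yS; rewrite inE.
  apply: eq_big => [S|S /andP[/and3P[xS sS gS] my]].
    case: (boolP (is_max y S)) => [/is_maxP[yS le_y]|]; last by rewrite !andbF.
    rewrite !andbT; apply/and3P/is_minP => [[xS /subsetP sS _]|[xS ge_x]].
      by split=> // z /sS; rewrite inE => /andP[].
    split=> //.
      by apply/subsetP=> z zS; rewrite inE ge_x // (leq_ltn_trans (le_y _ zS)).
    apply/gap_closedP=> p q pS qS z pz zq; rewrite inE.
    by have := ge_x _ pS; have := le_y _ qS; lia.
  have [yS le_y] := is_maxP _ _ my.
  have ge_x : {in S, forall z : 'I_n, x <= z}%N.
    by move=> z /(subsetP sS); rewrite inE => /andP[].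
  have mx : is_min x S by apply/is_minP.
  have tw' := tower_cons tw mx (erefl _) my; have [pT' ltD' _ _] := tw'.
  have -> : itv x b :\: S = (itv x y.+1 :\: S) :|: itv y.+1 b.
    apply/setP=> z; rewrite !inE.
    by case: (boolP (z \in S)) => [/le_y|_] /=; lia.
  have lt1 : {in itv x y.+1 :\: S, forall z : 'I_n, z < y}%N.
    move=> z /setDP[]; rewrite inE ltnS => /andP[_ zy] zS.
    by rewrite ltn_neqAle zy andbT val_eqE; apply: contraNneq zS => ->.
  have gt1 : {in itv x y.+1 :\: S, forall z : 'I_n, x < z}%N.
    move=> z /setDP[]; rewrite inE => /andP[xz _] zS.
    by rewrite ltn_neqAle xz andbT val_eqE; apply: contraNneq zS => <-.
  have gt2 : {in itv y.+1 b, forall z : 'I_n, y < z}%N.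
    by move=> z; rewrite inE => /andP[].
  rewrite (sum_good_split _ lt1 gt2) -mulrA mulr_suml mulr_sumr.
  apply: eq_bigr => s1 /goodP[p1 _ _]; rewrite !mulr_sumr.
  apply: eq_bigr => s2 /goodP[p2 _ _].
  have d12 := disjoint_lt_gt lt1 gt2.
  have dS : [disjoint S & (itv x y.+1 :\: S) :|: itv y.+1 b].
    apply/pred0P=> z /=; rewrite !inE; case: (boolP (z \in S)) => //= /le_y zy.
    by rewrite ltnNge zy.
  have dT : [disjoint S :|: D & itv y.+1 b].
    apply/pred0P=> z /=; apply/negP=> /andP[/ltD' zy /gt2].
    by rewrite ltnNge -ltnS zy.
  have d1 : [disjoint itv x y.+1 :\: S & (S :|: D) :|: itv y.+1 b].
    apply/pred0P=> z /=; apply/negP=> /andP[z1 /setUP[/setUP[zS|/ltD]|/gt2]].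
    + by case/setDP: z1 => _; rewrite zS.
    + by move=> zx; have := gt1 _ z1; rewrite ltnNge (ltnW zx).
    + by move=> yz; have := lt1 _ z1; rewrite ltnNge (ltnW yz).
  have -> : T :|: (S |: (s1 :|: s2)) = s1 :|: ((S |: T) :|: s2).
    by apply/setP=> B; rewrite !inE; do 4!case: (_ \in _) || case: (_ == _).
  rewrite (omegaU _ p1 (partitionU pT' p2 dT) d1); last first.
    move=> B1 B2 i1 i2; have sub1 := subsetP (partition_sub p1 i1).
    (* The gaps lie strictly between x and y; the extremal elements of all
       other blocks are too far away for an adjacency. *)
    have edge : (exists2 p, is_max p B2 & exists2 q, is_min q B2 &
        ((p < x) || (y <= p)) && ((q <= x) || (y < q)))%N.
      case/setUP: i2 => [/setU1P[->|Ti]|Ti].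
      - by exists y => //; exists x; rewrite // !leqnn orbT.
      - have B0 : B2 != set0 by apply/set0Pn; apply: partition_nonempty pT Ti.
        have [[p mp] [q mq]] := (max_exists B0, min_exists B0).
        have sub2 := subsetP (partition_sub pT Ti).
        exists p => //; exists q => //; have [pB _] := is_maxP _ _ mp.
        have [qB _] := is_minP _ _ mq.
        by rewrite ltD ?(ltnW (ltD _ _)) // sub2.
      - have B0 : B2 != set0 by apply/set0Pn; apply: partition_nonempty p2 Ti.
        have [[p mp] [q mq]] := (max_exists B0, min_exists B0).
        have sub2 := subsetP (partition_sub p2 Ti).
        exists p => //; exists q => //; have [pB _] := is_maxP _ _ mp.
        have [qB _] := is_minP _ _ mq.
        by rewrite (ltnW (gt2 _ _)) ?gt2 ?orbT // sub2.
    have [p /is_maxP[pB le_p] [q /is_minP[qB ge_q] pq]] := edge.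
    split; apply/existsP=> -[c /existsP[d /and3P[]]].
      move=> /is_maxP[ci _] /is_minP[di ge_d] /eqP e.
      move: (gt1 _ (sub1 _ ci)) (lt1 _ (sub1 _ ci)) (ge_d _ qB) (ge_q _ di) pq e.
      by clear; lia.
    move=> /is_maxP[ci le_c] /is_minP[di _] /eqP e.
    move: (gt1 _ (sub1 _ di)) (lt1 _ (sub1 _ di)) (le_c _ pB) (le_p _ ci) pq e.
    by clear; lia.
  rewrite (size_weightU (partition1 _) (partitionU p1 p2 d12) dS); last first.
    by apply/set0Pn; exists x.
  rewrite (size_weightU p1 p2 d12) {1}/size_weight big_set1.
  by rewrite mulrCA mulrACA.
- by rewrite inE leqnn.
- by move=> z; rewrite inE => /andP[].
Qed.

(** * Translation into power series *)

Lemma sum_ord_itv (V : nmodType) (a b : nat) (f : nat -> V) : (b <= n)%N ->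
  \sum_(e : 'I_n | (a <= e < b)%N) f e = \sum_(j < b - a) f (j + a)%N.
Proof.
move=> bn; transitivity (\sum_(a <= i < b) f i); last first.
  by rewrite -{1}[a]add0n big_addn big_mkord.
by rewrite big_geq_mkord (big_ord_widen_cond n).
Qed.

Variable G : {poly R}.

(** For a block with k+1 elements there are k gaps, each preceded by an element;
the factor ['X] of the remaining element is left out, as the series is indexed
by the distance between the extremal elements. *)
Definition gap_series (u : nat -> R) (K : nat) : {poly R} :=
  \sum_(k < K) (u k.+1)%:P * ('X * G) ^+ k.

Lemma gap_seriesS u K :
  gap_series u K.+1 = (u 1%N)%:P + 'X * (G * gap_series (fun k => u k.+1) K).
Proof.
rewrite /gap_series big_ord_recl expr0 mulr1; congr (_ + _).
by rewrite mulrA mulr_sumr; apply: eq_bigr => k _; rewrite exprS mulrCA.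
Qed.

(** The bound [L] makes the hypothesis available inside an induction on the
length of intervals: gaps are shorter than the block that contains them. *)
Lemma block_sum_coef L K u x y :
  (forall a b : nat, (a <= b <= n)%N -> (b - a < L)%N ->
     wsum (itv a b) = G`_(b - a)) ->
  (x <= y)%N -> (y - x <= L)%N -> (y - x < K)%N ->
  block_sum u x y = (gap_series u K)`_(y - x).
Proof.
move=> IH; elim: K u x => [//|K IHK] u x; rewrite leq_eqVlt => /orP[/eqP exy|xy].
  move=> _ _; rewrite -exy subnn gap_seriesS coefD coefC coefXM !eqxx addr0.
  by move/val_inj: exy => <-; apply: block_sum1.
move=> yxL yxK; rewrite block_sum_step // gap_seriesS coefD coefC coefXM.
rewrite [in RHS](_ : y - x = (y - x.+1).+1)%N; last by clear -xy; lia.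
rewrite /= add0r coefM.
rewrite (eq_bigr (fun e : 'I_n => G`_(e - x.+1) *
  (gap_series (fun k => u k.+1) K)`_(y - e))).
  rewrite (eq_bigl (fun e : 'I_n => x.+1 <= e < y.+1)%N) //.
  rewrite (@sum_ord_itv _ x.+1 y.+1 (fun e : nat => G`_(e - x.+1) *
    (gap_series (fun k => u k.+1) K)`_(y - e))) //.
  rewrite (_ : y.+1 - x.+1 = (y - x.+1).+1)%N; last by clear -xy; lia.
  apply: eq_bigr => j _; rewrite addnK; congr (_ * _`_ _).
  by clear; lia.
move=> e /andP[xe ey]; rewrite IH ?IHK //; try by clear IH IHK; lia.
by rewrite xe ltnW.
Qed.

Definition block_series : {poly R} := 'X * gap_series t n.

(** The number [j] of blocks already read shifts the weights; this makes
[chain_series] satisfy the recursion of [chain_sum_step]. *)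
Definition chain_series (j K : nat) : {poly R} :=
  \sum_(k < K) (w (j + k)%N)%:P * block_series ^+ k.

Lemma chain_seriesS j K : chain_series j K.+1 =
  (w j)%:P + 'X * (gap_series t n * chain_series j.+1 K).
Proof.
rewrite /chain_series big_ord_recl expr0 mulr1 addn0; congr (_ + _).
rewrite mulrA mulr_sumr; apply: eq_bigr => k _.
by rewrite exprS mulrCA lift0 addnS.
Qed.

Lemma itv_empty (a : nat) : itv a a = set0.
Proof. by apply/setP=> z; rewrite !inE; lia. Qed.

Lemma chain_sum_coef K (x b : nat) D (T : {set {set 'I_n}}) :
  tower x D T -> (x <= b <= n)%N -> (b - x < K)%N ->
  (forall a c : nat, (a <= c <= n)%N -> (c - a < b - x)%N ->
     wsum (itv a c) = G`_(c - a)) ->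
  chain_sum x b T = (chain_series #|T| K)`_(b - x).
Proof.
elim: K x D T => [//|K IHK] x D T tw /andP[+ bn]; rewrite leq_eqVlt.
case/orP=> [/eqP exb _ _|xb bxK IH].
  rewrite -exb subnn chain_seriesS coefD coefC coefXM !eqxx addr0 /chain_sum.
  rewrite itv_empty (eq_bigl _ _ good0) big_pred1_eq setU0.
  by rewrite (omega_tower w0 tw) /size_weight big_set0 mulr1.
have xn : (x < n)%N by apply: leq_trans bn.
pose x' := Ordinal xn; have [pT ltD _ _] := tw.
rewrite (@chain_sum_step x' b D T xb tw) chain_seriesS coefD coefC coefXM.
rewrite [in RHS](_ : b - x = (b - x.+1).+1)%N; last by clear -xb; lia.
rewrite /= add0r coefM.
rewrite (eq_bigr (fun y : 'I_n => (gap_series t n)`_(y - x) *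
  (chain_series #|T|.+1 K)`_(b - y.+1))).
  rewrite (@sum_ord_itv _ x b (fun y : nat => (gap_series t n)`_(y - x) *
    (chain_series #|T|.+1 K)`_(b - y.+1))) //.
  rewrite (_ : b - x = (b - x.+1).+1)%N; last by clear -xb; lia.
  apply: eq_bigr => j _; rewrite addnK; congr (_ * _`_ _).
  by clear; lia.
move=> y /andP[xy yb].
rewrite -(@block_sum_coef (y - x) n t x' y) //; first last.
- by rewrite /=; have := ltn_ord y; clear -xy; lia.
- by move=> a c acn ca; apply: IH => //; clear -ca xy yb; lia.
rewrite /block_sum mulr_suml; apply: eq_bigr => S /andP[mx my]; congr (_ * _).
rewrite (@IHK _ (S :|: D) (S |: T)).
- rewrite cardsU1 (_ : S \notin T) //.
  have [xS _] := is_minP _ _ mx; apply/negP=> ST.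
  by have := ltD _ (subsetP (partition_sub pT ST) _ xS); rewrite /= ltnn.
- exact: tower_cons tw mx _ my.
- by rewrite yb.
- by clear -bxK xy yb xb; lia.
- by move=> a c acn ca; apply: IH => //; clear -ca xy; lia.
Qed.

(** By strong induction on the length: the recursion computes the sum on an
interval from the sums on shorter ones, and the hypothesis says that the
coefficients of [G] solve the same recursion. *)
Lemma wsum_itv (a b : nat) :
  (forall L, (L <= n)%N -> G`_L = (chain_series 0 n.+1)`_L) ->
  (a <= b <= n)%N -> wsum (itv a b) = G`_(b - a).
Proof.
move=> GE; have [L] := ubnP (b - a); elim: L a b => // L IHL a b baL abn.
have -> : wsum (itv a b) = chain_sum a b set0.
  by apply: eq_bigr => pi _; rewrite set0U.
have ban : (b - a <= n)%N by clear -abn; lia.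
rewrite GE // (@chain_sum_coef n.+1 a b set0 set0) ?cards0 //.
  exact: tower0.
by move=> a' c' acn ca; apply: IHL => //; apply: leq_trans ca _.
Qed.

Lemma wsum_setT :
  (forall L, (L <= n)%N -> G`_L = (chain_series 0 n.+1)`_L) ->
  wsum [set: 'I_n] = G`_n.
Proof.
move=> GE; have -> : [set: 'I_n] = itv 0 n.
  by apply/setP=> x; rewrite !inE ltn_ord.
by rewrite wsum_itv // ?leqnn // subn0.
Qed.

End WeightedSums.

(** * The generating function modulo X^(n+1) *)

Section TruncatedSeries.

Variable R : comNzRingType.
Implicit Types (N : nat) (p q : {poly R}).

Definition eqm N p q : Prop := forall i, (i < N)%N -> p`_i = q`_i.

Lemma eqm_trans N p q r : eqm N p q -> eqm N q r -> eqm N p r.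
Proof. by move=> e f i iN; rewrite e ?f. Qed.

Lemma eqm_leq M N p q : (M <= N)%N -> eqm N p q -> eqm M p q.
Proof. by move=> MN e i iM; apply/e/(leq_trans iM). Qed.

Lemma eqmD N p q p' q' : eqm N p p' -> eqm N q q' -> eqm N (p + q) (p' + q').
Proof. by move=> e f i iN; rewrite !coefD e ?f. Qed.

Lemma eqmM N p q p' q' : eqm N p p' -> eqm N q q' -> eqm N (p * q) (p' * q').
Proof.
move=> e f i iN; rewrite !coefM; apply: eq_bigr => j _.
by rewrite e ?f //; apply: leq_ltn_trans iN; rewrite ?leq_subr // -ltnS.
Qed.

Lemma eqm_exp N p q k : eqm N p q -> eqm N (p ^+ k) (q ^+ k).
Proof. by move=> e; elim: k => [|k IHk] //; rewrite !exprS; apply: eqmM. Qed.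

Lemma eqm_sum N (I : Type) (r : seq I) (P : pred I) (f g : I -> {poly R}) :
  (forall i, P i -> eqm N (f i) (g i)) ->
  eqm N (\sum_(i <- r | P i) f i) (\sum_(i <- r | P i) g i).
Proof.
by move=> e; elim/big_ind2: _ => // p p' q q' ? ?; apply: eqmD.
Qed.

Lemma eqmX N p q : eqm N p q -> eqm N.+1 ('X * p) ('X * q).
Proof. by move=> e [|i] iN; rewrite !coefXM // e. Qed.

Variables (n : nat) (t : nat -> R).

Definition gf_map p : {poly R} := 1 + block_series n t p * p ^+ 2.

Lemma eqm_gap_series N p q u K : eqm N p q ->
  eqm N (gap_series p u K) (gap_series q u K).
Proof.
move=> e; apply: eqm_sum => i _; apply: eqmM => //.
by apply: eqm_exp; apply: eqmM.
Qed.

(** The factor ['X] of the block series gains one order of precision, hence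
[n.+1] iterations from any start give a fixed point modulo X^(n+1). *)
Lemma eqm_gf_map N p q : eqm N p q -> eqm N.+1 (gf_map p) (gf_map q).
Proof.
move=> e; apply: eqmD => //; rewrite /block_series -!mulrA; apply: eqmX.
by apply: eqmM; [apply: eqm_gap_series|apply: eqm_exp].
Qed.

Definition gf : {poly R} := iter n.+1 gf_map 0.

Local Notation A := (block_series n t gf).

Lemma gf_eqn : eqm n.+1 gf (1 + A * gf ^+ 2).
Proof.
have main k : eqm k (iter k gf_map 0) (iter k.+1 gf_map 0).
  by elim: k => [|k IHk] //; rewrite [iter k.+1 _ _]iterS; apply: eqm_gf_map.
exact: main.
Qed.

Lemma gf_expS r : eqm n.+1 (gf ^+ r.+1) (gf ^+ r + A * gf ^+ r.+2).
Proof.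
have -> : gf ^+ r + A * gf ^+ r.+2 = gf ^+ r * (1 + A * gf ^+ 2).
  by rewrite mulrDr mulr1 [gf ^+ r * _]mulrCA -exprD addn2.
by rewrite exprSr; apply: eqmM => //; apply: gf_eqn.
Qed.

(** The value at [k] and [r] is the coefficient of z^k in K^r, for K the Catalan
series: the recursion reads K^(r+1) = K^r + z K^(r+2) on coefficients. *)
Fixpoint ballot (k : nat) : nat -> nat :=
  if k is k'.+1 then fun r => (\sum_(i < r) ballot k' i.+2)%N else fun=> 1%N.

Lemma ballotS k r : ballot k.+1 r.+1 = (ballot k.+1 r + ballot k r.+2)%N.
Proof. by rewrite /= big_ord_recr. Qed.

(** The relation of [gf_expS] between powers of [gf] is the recursion of the
ballot numbers, and determines them because [A] is divisible by ['X]. *)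
Lemma gf_exp_ballot K r : (K <= n.+1)%N ->
  eqm K (gf ^+ r) (\sum_(k < K) (ballot k r)%:R%:P * A ^+ k).
Proof.
elim: K r => [//|K IHK] r Kn; elim: r => [|r IHr].
  rewrite big_ord_recl mulr1 big1 ?addr0 // => k _.
  by rewrite /= big_ord0 mul0r.
apply: eqm_trans (eqm_leq Kn (gf_expS r)) _.
apply: (@eqm_trans _ _ (\sum_(k < K.+1) (ballot k r)%:R%:P * A ^+ k +
    A * (\sum_(k < K) (ballot k r.+2)%:R%:P * A ^+ k))).
  apply: eqmD => //; rewrite /block_series -!mulrA; apply: eqmX.
  by apply: eqmM => //; apply: IHK; apply: ltnW.
rewrite !big_ord_recl -addrA mulr_sumr -big_split /=.
suff -> : \sum_(i < K) ((\sum_(i0 < r) ballot i i0.+2)%:R%:P * A ^+ bump 0 i +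
    A * ((ballot i r.+2)%:R%:P * A ^+ i)) =
  \sum_(i < K) (\sum_(i0 < r.+1) ballot i i0.+2)%:R%:P * A ^+ bump 0 i by [].
apply: eq_bigr => i _; rewrite big_ord_recr /= natrD polyCD mulrDl.
by rewrite /bump add1n exprS; congr (_ + _); rewrite mulrCA.
Qed.

Lemma gf_exp_blocks r L : (L <= n)%N ->
  (gf ^+ r.+1)`_L = (gf ^+ r)`_L +
    \sum_(s < n | (s < L)%N) t s.+1 * (gf ^+ (r + s).+2)`_(L - s.+1).
Proof.
move=> Ln; rewrite gf_expS // coefD; congr (_ + _).
rewrite /block_series /gap_series mulr_sumr mulr_suml coef_sum.
rewrite [RHS]big_mkcond /=; apply: eq_bigr => s _.
have -> : 'X * ((t s.+1)%:P * ('X * gf) ^+ s) * gf ^+ r.+2 =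
    (t s.+1)%:P * ('X^(s.+1) * gf ^+ (r + s).+2).
  have -> : gf ^+ (r + s).+2 = gf ^+ s * gf ^+ r.+2.
    by rewrite -exprD addnC !addnS.
  rewrite exprMn ['X^(s.+1)]exprS.
  by move: (gf ^+ s) (gf ^+ r.+2) ('X^s) => p q x; ring.
by rewrite coefCM coefXnM ltnS leqNgt; case: (s < L)%N; rewrite ?mulr0.
Qed.

End TruncatedSeries.

Lemma ballot_fact k r :
  (ballot k r.+1 * (k`! * (k + r.+1)`!) = r.+1 * (2 * k + r)`!)%N.
Proof.
elim: k r => [|k IHk] r; first by rewrite /= fact0 !mul1n factS.
elim: r => [|r IHr].
  rewrite ballotS /= big_ord0 add0n.
  have e2 : (2 * k.+1 + 0 = (2 * k + 1).+1)%N by lia.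
  have e1 : (k.+1 + 1 = k + 2)%N by lia.
  transitivity (k.+1 * (ballot k 2 * (k`! * (k + 2)`!)))%N.
    by rewrite e1 factS; ring.
  by rewrite IHk e2 factS; ring.
have e1 : (k.+1 + r.+2 = (k.+1 + r.+1).+1)%N by lia.
have e2 : (2 * k.+1 + r.+1 = (2 * k.+1 + r).+1)%N by lia.
have e3 : (2 * k + r.+2 = 2 * k.+1 + r)%N by lia.
have e4 : (k + r.+3 = (k.+1 + r.+1).+1)%N by lia.
have := IHk r.+2; rewrite e3 e4 => {}IHk.
rewrite ballotS e1 e2 mulnDl.
transitivity ((k.+1 + r.+1).+1 * (ballot k.+1 r.+1 * (k.+1`! * (k.+1 + r.+1)`!))
   + k.+1 * (ballot k r.+3 * (k`! * (k.+1 + r.+1).+1`!)))%N.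
  by rewrite [k.+1`!]factS [(k.+1 + r.+1).+1`!]factS; ring.
by rewrite IHr IHk factS; ring.
Qed.

Lemma catalan_ballot k : catalan k = (ballot k 1)%:R.
Proof.
have := ballot_fact k 0; rewrite mul1n addn0 addn1 => e.
have binE : ('C(2 * k, k) = ballot k 1 * k.+1)%N.
  apply/eqP; rewrite -(@eqn_pmul2r (k`! * k`!)) ?muln_gt0 ?fact_gt0 //.
  have k2 : (k <= 2 * k)%N by lia.
  have := bin_fact k2; rewrite (_ : 2 * k - k = k)%N; last by lia.
  by move=> ->; rewrite -e factS; apply/eqP; ring.
by rewrite /catalan binE natrM mulfK // pnatr_eq0.
Qed.

(** * Coefficients of monomials in the block variables *)

Section CoefficientExtraction.

Variable n : nat.
Implicit Types (mu : 'X_{1..n}) (i s : 'I_n).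

(** The variable of index [i] for [k] = [i.+1], and the trivial monomial for a
[k] that is not the size of a block. *)
Definition size_monomial (k : nat) : 'X_{1..n} :=
  [multinom (i.+1 == k : nat) | i < n].

Definition size_var (k : nat) : {mpoly rat[n]} := 'X_[size_monomial k].

Definition wdeg mu : nat := (\sum_(i < n) i.+1 * mu i)%N.

Definition mfact mu : nat := (\prod_(i < n) (mu i)`!)%N.

Local Notation G := (gf n size_var).

Lemma size_varS s : size_var s.+1 = 'X_s.
Proof.
by congr 'X_[_]; apply/mnmP=> i; rewrite mnmE mnm1E eqSS eq_sym val_eqE.
Qed.

Lemma mcoeffXM (p : {mpoly rat[n]}) s mu :
  ('X_s * p)@_mu = if mu s == 0%N then 0 else p@_(mu - U_(s)).
Proof.
rewrite mulrC; case: ifPn => [/eqP m0|].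
  rewrite mcoeffM big1 // => k /eqP ek; rewrite mcoeffX.
  case: eqP => [eU|]; last by rewrite mulr0.
  have := congr1 (fun nu : 'X_{1..n} => nu s) ek.
  by rewrite /= m0 mnmDE -eU mnm1E eqxx addn1.
by rewrite -lep1mP => /submK {1}<-; rewrite addmC mcoeffMX.
Qed.

Lemma wdegB mu s : mu s != 0%N -> wdeg mu = (s.+1 + wdeg (mu - U_(s)))%N.
Proof.
move=> ms; rewrite /wdeg (bigD1 s) //= [in RHS](bigD1 s) //= !mnmBE mnm1E eqxx.
rewrite addnA; congr (_ + _)%N.
  by case: (mu s) ms => // k _; rewrite subn1 mulnS.
by apply: eq_bigr => i nis; rewrite mnmBE mnm1E eq_sym (negbTE nis) subn0.
Qed.

Lemma mdegB1 mu s : mu s != 0%N -> mdeg mu = (mdeg (mu - U_(s))).+1.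
Proof. by rewrite -lep1mP => /submK {1}<-; rewrite mdegD mdeg1 addn1. Qed.

Lemma mfactB mu s : mu s != 0%N -> mfact mu = (mu s * mfact (mu - U_(s)))%N.
Proof.
move=> ms; rewrite /mfact (bigD1 s) //= [in RHS](bigD1 s) //= !mnmBE mnm1E eqxx.
rewrite mulnA subn1; case: (mu s) ms => // k _; rewrite factS; congr (_ * _)%N.
by apply: eq_bigr => i nis; rewrite mnmBE mnm1E eq_sym (negbTE nis) subn0.
Qed.

Lemma gf_exp_coeff0 r : ((G ^+ r)`_0)@_0%MM = 1.
Proof.
elim: r => [|r IHr]; first by rewrite expr0 coef1 mcoeff1 eqxx.
by rewrite gf_exp_blocks // big_pred0_eq // addr0.
Qed.

(** By induction on the degree of [mu], then on [r], from [gf_exp_blocks]. With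
L the weighted degree, d the degree and P the product of factorials, taking out
the variable of index s replaces L by L-s-1, d by d-1, r by r+s+2 and P by
P / mu_s, so that all terms share the factor (L+d+r-1)!; what remains is
r (L+r+1) + L + (r+1) d = (r+1) (L+d+r). The formula fails at
[mu] = 0, [r] = 0; the induction reaches [mu] = 0 through [gf_exp_coeff0]. *)
Lemma gf_exp_coeff r mu : (wdeg mu <= n)%N -> mu != 0%MM ->
  ((G ^+ r)`_(wdeg mu))@_mu * ((wdeg mu + r)`! * mfact mu)%:R =
  (r * (wdeg mu + mdeg mu + r).-1`!)%:R.
Proof.
have [d] := ubnP (mdeg mu); elim: d mu r => // d IHd mu r mud wn nz.
have dpos : (0 < mdeg mu)%N by rewrite lt0n mdeg_eq0.
elim: r => [|r IHr].
  rewrite expr0 coef1; case: eqP => _; last by rewrite mcoeff0 mul0r.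
  by rewrite mcoeff1 (negbTE nz) mul0r.
set L := wdeg mu in IHr wn *; set M := (L + mdeg mu + r).-1.
have termE s : (if (s < L)%N then size_var s.+1 * (G ^+ (r + s).+2)`_(L - s.+1)
    else 0)@_mu * ((L + r.+1)`! * mfact mu)%:R = ((r + s).+2 * mu s * M`!)%:R.
  case: (eqVneq (mu s) 0%N) => [m0|ms].
    rewrite m0 muln0 mul0n; case: ifP => _; last by rewrite mcoeff0 mul0r.
    by rewrite size_varS mcoeffXM m0 eqxx mul0r.
  have eL : L = _ := wdegB ms; have eD := mdegB1 ms.
  rewrite size_varS eL leq_addr addKn mcoeffXM (negbTE ms) (mfactB ms).
  set nu := (mu - U_(s))%MM in eL eD *.
  have eLr : (s.+1 + wdeg nu + r.+1 = wdeg nu + (r + s).+2)%N by lia.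
  rewrite eLr mulnCA natrM mulrCA.
  have [nu0|nunz] := eqVneq nu 0%MM.
    have w0 : wdeg nu = 0%N.
      by rewrite nu0 /wdeg big1 // => i _; rewrite mnm0E muln0.
    have d0 : mdeg nu = 0%N by rewrite nu0 mdeg0.
    have f0 : mfact nu = 1%N.
      by rewrite nu0 /mfact big1 // => i _; rewrite mnm0E.
    rewrite w0 f0 nu0 gf_exp_coeff0 mul1r muln1 add0n factS -natrM.
    have -> : M = (r + s).+1 by rewrite /M eL eD w0 d0; lia.
    by congr (_%:R); ring.
  rewrite IHd //; last first.
  - by apply: leq_trans wn; rewrite eL leq_addl.
  - by move: mud; rewrite eD.
  have -> : (wdeg nu + mdeg nu + (r + s).+2).-1 = M.
    by rewrite /M eL eD; lia.
  by rewrite -natrM; congr (_%:R); ring.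
rewrite gf_exp_blocks // mcoeffD big_mkcond (raddf_sum (mcoeff _)) mulrDl mulr_suml /=.
rewrite (eq_bigr _ (fun s _ => termE s)) -natr_sum.
have -> : ((L + r.+1)`! * mfact mu)%:R =
    ((L + r)`! * mfact mu)%:R * (L + r.+1)%:R :> rat.
  by rewrite -natrM addnS factS; congr (_%:R); ring.
rewrite mulrA IHr -/M -natrM -natrD; congr (_%:R).
have -> : (\sum_(s < n) (r + s).+2 * mu s * M`! =
    (L + r.+1 * mdeg mu) * M`!)%N.
  rewrite -big_distrl /=; congr (_ * _)%N.
  rewrite mdegE big_distrr /= /L /wdeg -big_split /=; apply: eq_bigr => s _.
  by ring.
have -> : (L + mdeg mu + r.+1).-1 = M.+1 by rewrite /M; lia.
have eM : M.+1 = (L + mdeg mu + r)%N by rewrite /M; lia.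
by rewrite factS eM; ring.
Qed.

Definition type_monomial (pi : {set {set 'I_n}}) : 'X_{1..n} :=
  (\sum_(B in pi) size_monomial #|B|)%MM.

Lemma type_monomialE pi i :
  type_monomial pi i = #|[set B in pi | #|B| == i.+1]|.
Proof.
rewrite mnm_sumE -sum1_card big_mkcond [RHS]big_mkcond /=.
apply: eq_bigr => B _; rewrite !inE mnmE eq_sym.
by case: (B \in pi) => //=; case: eqP.
Qed.

Lemma size_weightE pi : size_weight size_var pi = 'X_[type_monomial pi].
Proof. by rewrite /size_weight /size_var mprodXE. Qed.

Lemma omega_closure_weight (pi : {set {set 'I_n}}) :
  omega (fun k => (ballot k 1)%:R) pi = (closure_weight pi)%:MP_[n].
Proof.
rewrite /closure_weight rmorph_prod; apply: eq_bigr => p _.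
by rewrite catalan_ballot rmorph_nat.
Qed.

Lemma good_setT (pi : {set {set 'I_n}}) :
  good setT pi = partition pi setT && noncrossing pi.
Proof.
apply/goodP/andP => [[]//|[pT nc]]; split=> // B _; apply/gap_closedP=> x y _ _ z _ _.
by rewrite inE.
Qed.

Lemma wsum_coeff (m : nat -> nat) :
  (wsum (fun k => (ballot k 1)%:R) size_var [set: 'I_n])
    @_[multinom m i.+1 | i < n] = \sum_(pi in NC n m) closure_weight pi.
Proof.
rewrite /wsum (raddf_sum (mcoeff _)) [RHS]big_mkcond [LHS]big_mkcond /=.
apply: eq_bigr => pi _.
rewrite inE andbA -good_setT; case: (good setT pi) => //=.
rewrite omega_closure_weight size_weightE mcoeffCM mcoeffX.
suff -> : has_type m pi = (type_monomial pi == [multinom m i.+1 | i < n]).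
  by case: eqP; rewrite ?mulr1 ?mulr0.
apply/forallP/eqP => [h|/mnmP h i].
  by apply/mnmP=> i; rewrite mnmE type_monomialE; apply/eqP/h.
by have := h i; rewrite mnmE type_monomialE => ->.
Qed.

End CoefficientExtraction.

Theorem corollary25p11 (n : nat) (m : nat -> nat)
    (n_gt0 : (0 < n)%N) (hm : part_mult n m) :
  \sum_(pi in NC n m) closure_weight pi =
    ((n + \sum_(1 <= i < n.+1) m i)`!)%:R /
      (((n.+1)`! * \prod_(1 <= i < n.+1) (m i)`!)%N)%:R :> rat.
Proof.
set mu := [multinom m i.+1 | i < n].
have wmu : wdeg mu = n.
  rewrite -[RHS]hm.1 big_add1 big_mkord; apply: eq_bigr => i _.
  by rewrite mnmE.
have dmu : mdeg mu = (\sum_(1 <= i < n.+1) m i)%N.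
  by rewrite mdegE big_add1 big_mkord; apply: eq_bigr => i _; rewrite mnmE.
have fmu : mfact mu = (\prod_(1 <= i < n.+1) (m i)`!)%N.
  by rewrite /mfact big_add1 big_mkord; apply: eq_bigr => i _; rewrite mnmE.
have nz : mu != 0%MM.
  apply: contraTneq n_gt0 => mu0; rewrite -wmu mu0 /wdeg big1 // => i _.
  by rewrite mnm0E muln0.
rewrite -wsum_coeff (@wsum_setT _ _ _ _ _ (gf n (@size_var n))) //; last first.
  move=> L Ln; have := @gf_exp_ballot _ n (@size_var n) n.+1 1 (leqnn _) L Ln.
  by rewrite expr1.
have := @gf_exp_coeff n 1 mu; rewrite wmu leqnn expr1 mul1n addn1 dmu fmu addn1.
move=> /(_ isT nz) /= <-; rewrite mulfK // pnatr_eq0 -lt0n muln_gt0 fact_gt0.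
by rewrite prodn_gt0 // => i; apply: fact_gt0.
Qed.
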